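(* (a) A metric space is a uniform ANR if for each $\varepsilon>0$ it is uniformly $\varepsilon$-homotopy dominated by a uniform ANR. (b) Suppose that a metric space $X$ is uniformly embedded in a uniform ANR $Z$. Then $X$ is a uniform ANR if and only if for each $\varepsilon>0$ there exists a uniformly continuous map $\phi\colon U\to X$ of a uniform neighborhood $U$ of $X$ in $Z$ into $X$ such that $\phi|_X$ is uniformly $\varepsilon$-homotopic to $\mathrm{id}_X$ with values in $X$.
   Context: A uniform neighborhood of a subset $S$ of a metrizable uniform space $Z$ is a subset containing an $\varepsilon$-neighborhood of $S$ for some $\varepsilon>0$. A uniform ANR is a metrizable uniform space $Y$ such that for every uniform embedding $i$ of $Y$ onto a closed subspace of a metrizable uniform space $Z$ there exists a uniformly continuous retraction of some uniform neighborhood of $i(Y)$ in $Z$ onto $i(Y)$. A metric space is called a uniform ANR if its underlying uniform space is. Two uniformly continuous maps $f,g\colon Y\to X$ into a metric space are uniformly $\varepsilon$-homotopic (with values in $X$) if they are joined by a uniformly continuous homotopy $Y\times[0,1]\to X$ that is $\varepsilon$-close to the composition $Y\times[0,1]\xrightarrow{\text{projection}}Y\xrightarrow{f}X$. In (b) the embedding of $X$ in $Z$ need not be onto a closed subset. A metric space $X$ is uniformly $\varepsilon$-homotopy dominated by a uniform space $Y$ if there exist uniformly continuous maps $u\colon X\to Y$ and $d\colon Y\to X$ such that the composition $d\circ u\colon X\to X$ is uniformly $\varepsilon$-homotopic to $\mathrm{id}_X$. *)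

(* Defs.v *)
From HB Require Import structures.
From mathcomp Require Import all_boot all_order all_algebra.
From mathcomp Require Import all_classical all_reals.
From mathcomp Require Import topology normedtype.

Set Implicit Arguments.
Unset Strict Implicit.
Unset Printing Implicit Defensive.

Import Order.TTheory GRing.Theory Num.Theory.
Import numFieldTopology.Exports.

Local Open Scope classical_set_scope.
Local Open Scope ring_scope.

(* A set [A : set T] used as a type is the sigma type [set_type A]; if [T] is a
   uniform space it carries the subspace uniformity. *)

Section Corestriction.
Context {S T : Type}.

Definition corestrict (f : S -> T) (A : set T) (fA : forall x, A (f x)) :
  S -> A := fun x => SigSub (mem_set (fA x)).

Lemma range_mem (f : S -> T) (x : S) : range f (f x).
Proof. by exists x. Qed.

End Corestriction.

Definition unif_embedding (Y Z : uniformType) (i : Y -> Z) : Prop :=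
  unif_continuous i /\
  exists g : range i -> Y,
    [/\ unif_continuous g,
        cancel (corestrict (range_mem i)) g &
        cancel g (corestrict (range_mem i))].

Section Metrizable.
Context {R : realType} {Z : uniformType}.

Definition compatible_metric (d : Z -> Z -> R) : Prop :=
  [/\ forall x y, d x y = 0 <-> x = y,
      forall x y, d x y = d y x,
      forall x y z, d x z <= d x y + d y z &
      @entourage Z = entourage_ (fun x e => [set y | d x y < e])].

Definition eps_nbhd (d : Z -> Z -> R) (S : set Z) (e : R) : set Z :=
  [set z | exists2 x, S x & d x z < e].

End Metrizable.

Definition unif_metrizable (R : realType) (Z : uniformType) : Prop :=
  exists d : Z -> Z -> R, compatible_metric d.

(* The choice of the compatible metric does not matter: see [unif_nbhdP]. *)
Definition unif_nbhd (R : realType) (Z : uniformType) (S U : set Z) : Prop :=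
  exists2 d : Z -> Z -> R, compatible_metric d &
    exists2 e : R, 0 < e & eps_nbhd d S e `<=` U.

Lemma unif_nbhdP (R : realType) (Z : uniformType) (S U : set Z)
    (d : Z -> Z -> R) : compatible_metric d ->
  unif_nbhd R S U <-> exists2 e : R, 0 < e & eps_nbhd d S e `<=` U.
Proof.
move=> cd; split=> [[d' [_ _ _ E'] [e e0 eU]]|]; last by exists d.
have [_ _ _ E] := cd.
have : @entourage Z [set xy | d' xy.1 xy.2 < e] by rewrite E'; exists e.
rewrite E => -[k k0 kE]; exists k => // z [x Sx xz].
by apply: eU; exists x => //; exact: (kE (x, z)).
Qed.

Lemma unif_nbhd_sub (R : realType) (Z : uniformType) (S U : set Z) :
  unif_nbhd R S U -> S `<=` U.
Proof.
move=> [d [d0 _ _ _] [e e0 eU]] x Sx; apply: eU; exists x => //.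
by have /d0 -> : x = x by [].
Qed.

Definition unif_retraction (Z : uniformType) (U A : set Z) (r : U -> A) : Prop :=
  unif_continuous r /\ forall u : U, A (set_val u) -> set_val (r u) = set_val u.

Definition unif_ANR (R : realType) (Y : uniformType) : Prop :=
  unif_metrizable R Y /\
  forall (Z : uniformType) (i : Y -> Z),
    unif_metrizable R Z -> unif_embedding i -> closed (range i) ->
    exists2 U : set Z, unif_nbhd R (range i) U &
      exists r : U -> range i, unif_retraction r.

Section Homotopy.
Context {R : realType}.

Definition unit_itv : set R := `[0, 1]%classic.

Lemma unit_itv0 : unit_itv 0.
Proof. by rewrite /unit_itv /= in_itv /= lexx ler01. Qed.

Lemma unit_itv1 : unit_itv 1.
Proof. by rewrite /unit_itv /= in_itv /= lexx ler01. Qed.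

Definition I0 : unit_itv := SigSub (mem_set unit_itv0).
Definition I1 : unit_itv := SigSub (mem_set unit_itv1).

Definition unif_eps_homotopic (Y : uniformType) (X : metricType R) (e : R)
    (f g : Y -> X) : Prop :=
  exists H : Y * unit_itv -> X,
    [/\ unif_continuous H,
        forall y, H (y, I0) = f y,
        forall y, H (y, I1) = g y &
        forall p, mdist (H p) (f p.1) < e].

Definition unif_eps_dominated (e : R) (X : metricType R) (Y : uniformType) :
    Prop :=
  exists (u : X -> Y) (d : Y -> X),
    [/\ unif_continuous u, unif_continuous d &
        unif_eps_homotopic e (d \o u) idfun].

End Homotopy.

(* Main.v *)
From HB Require Import structures.
Require Import Defs.
From mathcomp Require Import all_boot all_order all_algebra.
From mathcomp Require Import all_classical all_reals.
From mathcomp Require Import topology normedtype.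
From mathcomp Require Import lra.

(** Being a uniform ANR is an extension property: a uniformly continuous map
    into the space, given on a closed subset, extends uniformly continuously
    to a uniform neighborhood ([extensor]; the two directions are
    [extensor_unif_ANR] and [unif_ANR_extensor]).  For the implication from
    retractions to extensions, the target [Y] is embedded isometrically in the
    functions on [Y] (Kuratowski), into which maps extend by an infimum
    formula; adding a real coordinate that records the distance to the domain,
    and deleting the points of height [0] off the image of [Y], makes this
    image closed even though [Y] need not be complete.

    The hypotheses of (a) and (b) both give an approximate form of the
    extension property ([approx_extensor]): for each [e], a map on a closed
    set extends to a uniform neighborhood up to a uniform homotopy of size
    [e].  In (a), compose with [X -> Y], extend, and come back; in (b), extend
    into [Z] and apply the map from the neighborhood of [X].

    The core is that approximate extension implies extension
    ([approx_extensor_extensor]).  Let [g], near the closed set [A], be joined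
    over [A] to the given map [f] by an [e]-small homotopy [H].  The union of
    [H] and [g] is a map on [A * I] with [V * 0] attached, and it extends
    approximately in turn.  Sweeping the parameter from the bottom to the top
    of this extension as a point approaches [A] changes [g] only near [A] and
    by at most [5 * e], and the new map is joined to [f] over [A] by an
    arbitrarily small homotopy ([improvement]).  Iterating with [e = 2 ^- n]
    gives a uniformly Cauchy sequence that is eventually constant at each
    point off the closed set [A] and tends to [f] on [A]; its limit is the
    extension.

    For the converse in (b), [X] is closed in [Z * R] minus the points of
    height [0] off [X].  A retraction onto [X] there, restricted to a small
    positive height, is the required map, and moving the height down to [0]
    is the homotopy ([unif_ANR_near_retraction]).

    Uniform continuity is treated with moduli for pseudometrics on bare types,
    and a map on a subset is a total function with arbitrary values elsewhere;
    this lets the improvement step work on the plain product [W * R]. *)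

Set Implicit Arguments.
Unset Strict Implicit.
Unset Printing Implicit Defensive.

Import Order.TTheory GRing.Theory Num.Theory.
Import numFieldTopology.Exports.

Local Open Scope classical_set_scope.
Local Open Scope ring_scope.

(** * Uniform continuity on subsets of pseudometric spaces *)

Section Pseudometrics.
Context {R : realType}.

Definition pseudometric (T : Type) (d : T -> T -> R) : Prop :=
  [/\ forall x, d x x = 0, forall x y, d x y = d y x &
      forall x y z, d x z <= d x y + d y z].

Definition tube (T : Type) (d : T -> T -> R) (A : set T) (e : R) : set T :=
  [set z | exists2 a, A a & d a z < e].

Definition dclosed (T : Type) (d : T -> T -> R) (A : set T) : Prop :=
  forall z, (forall e, 0 < e -> tube d A e z) -> A z.

Definition ucont_on (S T : Type) (dS : S -> S -> R) (A : set S)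
    (dT : T -> T -> R) (f : S -> T) : Prop :=
  forall e, 0 < e -> exists2 k, 0 < k &
    forall x y, A x -> A y -> dS x y < k -> dT (f x) (f y) < e.

Definition dreal (x y : R) : R := `|x - y|.

Definition dprod (S T : Type) (dS : S -> S -> R) (dT : T -> T -> R)
    (p q : S * T) : R := dS p.1 q.1 + dT p.2 q.2.

Lemma pseudometric_ge0 (T : Type) (d : T -> T -> R) :
  pseudometric d -> forall x y, 0 <= d x y.
Proof.
by move=> [d0 ds dt] x y; have := dt x y x; rewrite d0 (ds y x); lra.
Qed.

Lemma dreal_pseudometric : pseudometric dreal.
Proof.
rewrite /dreal; split=> [x|x y|x y z]; first by rewrite subrr normr0.
  exact: distrC.
by have := ler_normD (x - y) (y - z); rewrite addrA subrK.
Qed.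

Lemma dprod_pseudometric (S T : Type) (dS : S -> S -> R) (dT : T -> T -> R) :
  pseudometric dS -> pseudometric dT -> pseudometric (dprod dS dT).
Proof.
rewrite /dprod => -[s0 ss st] [t0 ts tt]; split=> [x|x y|x y z].
- by rewrite s0 t0 addr0.
- by rewrite ss ts.
- by have := st x.1 y.1 z.1; have := tt x.2 y.2 z.2; lra.
Qed.

Lemma tubeS (T : Type) (d : T -> T -> R) (A B : set T) (e k : R) :
  A `<=` B -> e <= k -> tube d A e `<=` tube d B k.
Proof.
by move=> AB ek z [a Aa az]; exists a; [exact: AB|exact: lt_le_trans ek].
Qed.

Lemma sub_tube (T : Type) (d : T -> T -> R) (A : set T) (e : R) :
  pseudometric d -> 0 < e -> A `<=` tube d A e.
Proof. by move=> [d0 _ _] e0 z Az; exists z; rewrite ?d0. Qed.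

Lemma dclosedU (T : Type) (d : T -> T -> R) (A B : set T) :
  dclosed d A -> dclosed d B -> dclosed d (A `|` B).
Proof.
move=> cA cB z zAB; apply: contrapT => /not_orP[nA nB].
have /existsNP[e /not_implyP[e0 nAe]] : ~ forall e, 0 < e -> tube d A e z.
  by move=> /cA.
have /existsNP[k /not_implyP[k0 nBk]] : ~ forall e, 0 < e -> tube d B e z.
  by move=> /cB.
have m0 : 0 < Num.min e k by rewrite lt_min e0.
have [x [Ax|Bx]] := zAB _ m0; rewrite lt_min => /andP[xe xk].
  by apply: nAe; exists x.
by apply: nBk; exists x.
Qed.

Lemma dclosedX (S T : Type) (dS : S -> S -> R) (dT : T -> T -> R)
    (A : set S) (B : set T) : pseudometric dS -> pseudometric dT ->
  dclosed dS A -> dclosed dT B -> dclosed (dprod dS dT) (A `*` B).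
Proof.
move=> pS pT cA cB [x y] xyAB; split=> /=.
  apply: cA => e /xyAB[[a b] [/= Aa _]].
  rewrite /dprod/= => abe; exists a => //.
  by have := pseudometric_ge0 pT b y; lra.
apply: cB => e /xyAB[[a b] [/= _ Bb]].
rewrite /dprod/= => abe; exists b => //.
by have := pseudometric_ge0 pS a x; lra.
Qed.

Lemma ucont_onS (S T : Type) (dS : S -> S -> R) (A B : set S)
    (dT : T -> T -> R) (f : S -> T) :
  A `<=` B -> ucont_on dS B dT f -> ucont_on dS A dT f.
Proof.
move=> AB fB e /fB[k k0 fk]; exists k => // x y /AB Bx /AB By; exact: fk.
Qed.

Lemma ucont_on_comp (S T U : Type) (dS : S -> S -> R) (A : set S)
    (dT : T -> T -> R) (B : set T) (dU : U -> U -> R) (f : S -> T)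
    (g : T -> U) : (forall x, A x -> B (f x)) ->
  ucont_on dS A dT f -> ucont_on dT B dU g -> ucont_on dS A dU (g \o f).
Proof.
move=> AB fA gB e /gB[k /fA[m m0 fm] gk]; exists m => // x y Ax Ay xy.
by apply: gk; [exact: AB|exact: AB|exact: fm].
Qed.

Lemma ucont_on_pair (S T U : Type) (dS : S -> S -> R) (A : set S)
    (dT : T -> T -> R) (dU : U -> U -> R) (f : S -> T) (g : S -> U) :
  ucont_on dS A dT f -> ucont_on dS A dU g ->
  ucont_on dS A (dprod dT dU) (fun x => (f x, g x)).
Proof.
move=> fA gA e e0; have e20 : 0 < e / 2 by lra.
have [k k0 fk] := fA _ e20; have [m m0 gm] := gA _ e20.
exists (Num.min k m); first by rewrite lt_min k0.
move=> x y Ax Ay; rewrite lt_min => /andP[xk xm]; rewrite /dprod/=.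
by have := fk _ _ Ax Ay xk; have := gm _ _ Ax Ay xm; lra.
Qed.

Lemma lip_ucont_on (S T : Type) (dS : S -> S -> R) (A : set S)
    (dT : T -> T -> R) (f : S -> T) (L : R) : 0 <= L ->
  (forall x y, A x -> A y -> dT (f x) (f y) <= L * dS x y) ->
  ucont_on dS A dT f.
Proof.
move=> L0 fL e e0; have L1 : 0 < L + 1 by lra.
exists (e / (L + 1)); first by rewrite divr_gt0.
move=> x y Ax Ay; rewrite ltr_pdivlMr// => xy.
apply: (le_lt_trans (fL _ _ Ax Ay)).
have [d0|d0] := leP 0 (dS x y); first by nra.
by apply: le_lt_trans e0; rewrite mulr_ge0_le0// ltW.
Qed.

Lemma ucont_on_id (S : Type) (dS : S -> S -> R) (A : set S) :
  ucont_on dS A dS id.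
Proof. by move=> e e0; exists e. Qed.

Lemma ucont_on_cst (S T : Type) (dS : S -> S -> R) (A : set S)
    (dT : T -> T -> R) (c : T) : pseudometric dT ->
  ucont_on dS A dT (fun=> c).
Proof. by move=> [d0 _ _] e e0; exists 1 => // x y _ _ _; rewrite d0. Qed.

Lemma ucont_on_fst (S T : Type) (dS : S -> S -> R) (dT : T -> T -> R)
    (A : set (S * T)) : pseudometric dT -> ucont_on (dprod dS dT) A dS fst.
Proof.
move=> pT e e0; exists e => // x y _ _; rewrite /dprod.
by have := pseudometric_ge0 pT x.2 y.2; lra.
Qed.

Lemma ucont_on_snd (S T : Type) (dS : S -> S -> R) (dT : T -> T -> R)
    (A : set (S * T)) : pseudometric dS -> ucont_on (dprod dS dT) A dT snd.
Proof.
move=> pS e e0; exists e => // x y _ _; rewrite /dprod.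
by have := pseudometric_ge0 pS x.1 y.1; lra.
Qed.

(** The two pieces agree on the whole strip where [t] lies between [p] and [q],
    and two close points always lie in a common piece: so no modulus has to be
    traded across the seam. *)
Lemma ucont_on_glue (S T : Type) (dS : S -> S -> R) (V : set S)
    (dT : T -> T -> R) (t : S -> R) (p q : R) (f g : S -> T) :
  p < q -> ucont_on dS V dreal t ->
  ucont_on dS (V `&` [set x | t x <= q]) dT f ->
  ucont_on dS (V `&` [set x | p <= t x]) dT g ->
  (forall x, V x -> p <= t x <= q -> f x = g x) ->
  ucont_on dS V dT (fun x => if t x <= p then f x else g x).
Proof.
move=> pq tV fV gV fg e e0.
have [k k0 tk] := tV _ (ltac:(lra) : 0 < q - p).
have [m m0 fm] := fV _ e0; have [n n0 gn] := gV _ e0.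
exists (Num.min k (Num.min m n)); first by rewrite !lt_min k0 m0.
move=> x y Vx Vy; rewrite !lt_min => /and3P[xyk xym xyn].
have := tk _ _ Vx Vy xyk; rewrite /dreal ltr_distl => /andP[t1 t2].
have fE z : V z -> t z <= q -> (if t z <= p then f z else g z) = f z.
  move=> Vz zq; case: leP => // pz; rewrite fg// zq andbT; exact: ltW.
have gE z : V z -> p <= t z -> (if t z <= p then f z else g z) = g z.
  by move=> Vz zp; case: leP => // pz; rewrite fg// zp/=; lra.
have [xyp|] := boolP ((t x <= p) || (t y <= p)).
  have [xq yq] : t x <= q /\ t y <= q by case/orP: xyp => ?; lra.
  have := fm _ _ (conj Vx xq) (conj Vy yq) xym.
  by rewrite (fE _ Vx xq) (fE _ Vy yq).
rewrite negb_or -!ltNge => /andP[/ltW px /ltW py].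
have := gn _ _ (conj Vx px) (conj Vy py) xyn.
by rewrite (gE _ Vx px) (gE _ Vy py).
Qed.

Definition clamp (x : R) : R := if x <= 0 then 0 else if 1 <= x then 1 else x.

Lemma clamp_itv x : 0 <= clamp x <= 1.
Proof. by rewrite /clamp; case: (leP x 0) => ?; [|case: (leP 1 x) => ?]; lra. Qed.

Lemma clamp_id x : 0 <= x <= 1 -> clamp x = x.
Proof. by rewrite /clamp; case: (leP x 0) => ?; [|case: (leP 1 x) => ?]; lra. Qed.

Lemma clamp_le0 x : x <= 0 -> clamp x = 0.
Proof. by rewrite /clamp => ->. Qed.

Lemma clamp_ge1 x : 1 <= x -> clamp x = 1.
Proof. by rewrite /clamp; case: (leP x 0) => ?; [|case: (leP 1 x) => ?]; lra. Qed.

Lemma clamp_lip x y : `|clamp x - clamp y| <= `|x - y|.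
Proof.
wlog xy : x y / x <= y => [h|].
  have [/h//|/ltW/h] := leP x y.
  by rewrite distrC [X in _ <= X]distrC.
rewrite (distrC x) (ger0_norm (_ : 0 <= y - x)) ?subr_ge0// ler_norml /clamp.
case: (leP x 0) => ?; [|case: (leP 1 x) => ?];
  (case: (leP y 0) => ?; [|case: (leP 1 y) => ?]); lra.
Qed.

Lemma ucont_on_affine_clamp (S : Type) (dS : S -> S -> R) (A : set S)
    (t : S -> R) (m b : R) : ucont_on dS A dreal t ->
  ucont_on dS A dreal (fun x => clamp (m * t x + b)).
Proof.
move=> tA; apply: (@ucont_on_comp _ _ _ _ _ _ setT _ t
  (fun x => clamp (m * x + b)) _ tA) => //.
apply: (@lip_ucont_on _ _ _ _ _ (fun x => clamp (m * x + b)) `|m|) => // x y _ _.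
rewrite /dreal -normrM mulrBr; apply: le_trans (clamp_lip _ _) _.
by rewrite opprD addrACA subrr addr0.
Qed.

Section Infimum.
Context {T : Type}.
Implicit Types (A : set T) (F G : T -> R).

Definition infon A F : R := inf [set F a | a in A].

Lemma infon_le A F a : (forall b, A b -> 0 <= F b) -> A a -> infon A F <= F a.
Proof.
move=> F0 Aa; apply: ge_inf; last by exists a.
by exists 0 => _ [b Ab <-]; exact: F0.
Qed.

Lemma le_infon A F c : A !=set0 -> (forall b, A b -> c <= F b) ->
  c <= infon A F.
Proof.
move=> [a Aa] cF; apply: lb_le_inf; first by exists (F a); exists a.
by move=> _ [b Ab <-]; exact: cF.
Qed.

Lemma infon_lt A F c : A !=set0 -> infon A F < c -> exists2 a, A a & F a < c.
Proof.
move=> A0 Fc; apply: contrapT => nFc; move: Fc; apply/negP; rewrite -leNgt.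
apply: le_infon => // b Ab; rewrite leNgt; apply/negP => Fb.
by apply: nFc; exists b.
Qed.

Lemma infon_lip A F G c : A !=set0 -> (forall b, A b -> 0 <= F b) ->
  (forall a, A a -> F a <= G a + c) -> infon A F <= infon A G + c.
Proof.
move=> A0 F0 FG; rewrite -lerBlDr; apply: le_infon => // b Ab.
by have := FG b Ab; have := infon_le F0 Ab; lra.
Qed.

End Infimum.

(** Since [inf set0 = 0], the distance to a set is meaningful only when the set
    is nonempty. *)
Section DistanceToSet.
Context {T : Type} (d : T -> T -> R) (A : set T).
Hypotheses (pd : pseudometric d) (A0 : A !=set0).

Definition setdist (z : T) : R := infon A (d^~ z).

Lemma setdist_lt z e : setdist z < e <-> tube d A e z.
Proof.
split; first exact: infon_lt.
move=> [a Aa]; apply: le_lt_trans; apply: (@infon_le _ A (d^~ z)) => // b _.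
exact: pseudometric_ge0.
Qed.

Lemma setdist_ge0 z : 0 <= setdist z.
Proof. by apply: le_infon => // b _; exact: pseudometric_ge0. Qed.

Lemma setdist_in z : A z -> setdist z = 0.
Proof.
move=> Az; apply/eqP; rewrite eq_le setdist_ge0 andbT.
have [d0 _ _] := pd.
have /le_trans := @infon_le _ A (d^~ z) z (fun b _ => pseudometric_ge0 pd b z) Az.
by apply; rewrite d0.
Qed.

Lemma setdist_eq0 z : dclosed d A -> setdist z = 0 -> A z.
Proof. by move=> cA z0; apply: cA => e e0; apply/setdist_lt; rewrite z0. Qed.

Lemma setdist_lip x y : dreal (setdist x) (setdist y) <= d x y.
Proof.
have [_ ds dt] := pd.
have lip u v : setdist u <= setdist v + d u v.
  apply: infon_lip => // [b _|a _]; first exact: pseudometric_ge0.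
  by rewrite (ds u v); exact: dt.
rewrite /dreal ler_norml; have := lip x y; have := lip y x.
by rewrite (ds y x); lra.
Qed.

Lemma setdist_ucont_on B : ucont_on d B dreal setdist.
Proof.
apply: (@lip_ucont_on _ _ _ _ _ _ 1) => // x y _ _.
by rewrite mul1r; exact: setdist_lip.
Qed.

End DistanceToSet.

End Pseudometrics.

(** * Improving an approximate extension *)

Section Extensors.
Context {R : realType}.

(** The uniform analogue of an absolute neighborhood extensor.  The
    domain carries a pseudometric, so that products and subspaces can serve as
    domains without a check of separation. *)
Definition extensor (X : Type) (dX : X -> X -> R) : Prop :=
  forall (W : Type) (d : W -> W -> R) (A : set W) (f : W -> X),
    pseudometric d -> dclosed d A -> ucont_on d A dX f ->
    exists (k : R) (g : W -> X),
      [/\ 0 < k, ucont_on d (tube d A k) dX g & forall a, A a -> g a = f a].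

Definition itv01 : set R := [set t | 0 <= t <= 1].

(** Closeness is measured from the end [f], which stays fixed throughout the
    improvement, and not from the start [g], which does not. *)
Definition homotopy_to (W X : Type) (d : W -> W -> R) (dX : X -> X -> R)
    (A : set W) (e : R) (g f : W -> X) (K : W * R -> X) : Prop :=
  [/\ ucont_on (dprod d dreal) (A `*` itv01) dX K,
      forall a, A a -> K (a, 0) = g a,
      forall a, A a -> K (a, 1) = f a &
      forall a t, A a -> itv01 t -> dX (K (a, t)) (f a) <= e].

(** The common content of the hypotheses of (a) and (b). *)
Definition approx_extensor (X : Type) (dX : X -> X -> R) : Prop :=
  forall (e : R) (W : Type) (d : W -> W -> R) (A : set W) (f : W -> X),
    0 < e -> pseudometric d -> dclosed d A -> ucont_on d A dX f ->
    exists (k : R) (g : W -> X) (K : W * R -> X),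
      [/\ 0 < k, ucont_on d (tube d A k) dX g & homotopy_to d dX A e g f K].

Lemma itv01_0 : itv01 0. Proof. by rewrite /itv01/= lexx ler01. Qed.
Lemma itv01_1 : itv01 1. Proof. by rewrite /itv01/= lexx ler01. Qed.

Lemma itv01_clamp x : itv01 (clamp x). Proof. exact: clamp_itv. Qed.

Lemma dclosed_itv01 : dclosed dreal itv01.
Proof.
move=> t tI; rewrite /itv01/=; apply/andP; split; rewrite leNgt; apply/negP => h.
  have [|s /andP[s0 s1]] := tI (- t); first by lra.
  by rewrite /dreal ltr_distl => /andP[? ?]; lra.
have [|s /andP[s0 s1]] := tI (t - 1); first by lra.
by rewrite /dreal ltr_distl => /andP[? ?]; lra.
Qed.

Lemma dclosed_set0R : dclosed dreal [set (0 : R)].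
Proof.
move=> t t0; apply/eqP; rewrite -normr_eq0; apply/negPn/negP => n0.
have [|s ->] := t0 `|t|; first by rewrite lt_neqAle eq_sym n0 normr_ge0.
by rewrite /dreal sub0r normrN ltxx.
Qed.

Lemma dclosed_setdist_le (W : Type) (d : W -> W -> R) (A : set W) (c : R) :
  pseudometric d -> A !=set0 -> dclosed d [set z | setdist d A z <= c].
Proof.
move=> pd A0 z zc /=; rewrite leNgt; apply/negP => h.
have [|y /= yc yz] := zc (setdist d A z - c); first by lra.
have := le_lt_trans (setdist_lip pd A0 y z) yz.
by rewrite /dreal ltr_distl => /andP[? ?]; lra.
Qed.

Section Improvement.
Context (X : Type) (dX : X -> X -> R) (W : Type) (d : W -> W -> R).
Context (A V : set W) (f : W -> X).
Hypotheses (pX : pseudometric dX) (pd : pseudometric d).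
Hypotheses (cA : dclosed d A) (A0 : A !=set0).
Hypotheses (cV : dclosed d V) (AV : A `<=` V).

(** The homotopy [H] cannot be extended off [A] directly.  Instead, the union
    [h] of [H] and [g] is extended approximately, to [hh], with a small
    homotopy [K] from [hh] to [h].  The new map is [g] far from [A], runs
    backwards through [K] over the bottom copy of [V] while [z] comes closer,
    and then climbs through [hh] to the top copy of [A].  There it is joined
    to [f] by [K] again. *)
Lemma improvement (e e' k : R) (g : W -> X) (H : W * R -> X) :
  approx_extensor dX -> 0 < e' -> e' <= e -> 0 < k ->
  ucont_on d V dX g -> homotopy_to d dX A e g f H ->
  exists (g' : W -> X) (H' : W * R -> X),
    [/\ ucont_on d V dX g', homotopy_to d dX A e' g' f H',
        forall z, V z -> ~ tube d A k z -> g' z = g z &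
        forall z, V z -> dX (g' z) (g z) <= 5 * e].
Proof.
move=> apX e'0 e'e k0 gV [HA H0 H1 He].
have [_ dXs dXt] := pX.
have pR := @dreal_pseudometric R.
have pW : pseudometric (dprod d (@dreal R)) by exact: dprod_pseudometric.
(* [A * I] with [V] attached along its bottom. *)
pose B := (A `*` itv01) `|` (V `*` [set (0 : R)]).
have cB : dclosed (dprod d (@dreal R)) B.
  apply: dclosedU; apply: dclosedX => //; first exact: dclosed_itv01.
  exact: dclosed_set0R.
pose h (p : W * R) := if p.2 == 0 then g p.1 else H p.
have h0 z : h (z, 0) = g z by rewrite /h/= eqxx.
have hH a t : A a -> h (a, t) = H (a, t).
  by move=> Aa; rewrite /h/=; case: eqP => // ->; rewrite H0.
have hB : ucont_on (dprod d (@dreal R)) B dX h.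
  move=> c c0; have c20 : 0 < c / 2 by lra.
  have [m m0 Hm] := HA _ c20; have [n n0 gn] := gV _ c20.
  have mixed a t z : A a -> itv01 t -> V z ->
      dprod d dreal (a, t) (z, 0) < Num.min m n -> dX (h (a, t)) (h (z, 0)) < c.
    move=> Aa It Vz; rewrite lt_min /dprod/= => /andP[dm dn].
    have tm : dprod d dreal (a, t) (a, 0) < m.
      have [dd0 _ _] := pd; rewrite /dprod/= dd0.
      by have := pseudometric_ge0 pd a z; lra.
    have az : d a z < n.
      by have := pseudometric_ge0 pR t 0; lra.
    have := Hm (a, t) (a, 0) (conj Aa It) (conj Aa itv01_0) tm.
    have := gn a z (AV Aa) Vz az.
    rewrite h0 hH// H0//.
    by have := dXt (H (a, t)) (g a) (g z); lra.
  exists (Num.min m n); first by rewrite lt_min m0.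
  have [_ Ws _] := pW.
  move=> [x s] [y t] [[/= Ax Is]|[/= Vx ->]] [[/= Ay It]|[/= Vy ->]] xy.
  - rewrite !hH//; have : c / 2 < c by lra.
    apply: lt_trans; apply: Hm => //.
    by apply: lt_le_trans xy _; rewrite ge_min lexx.
  - exact: mixed.
  - by rewrite dXs; apply: mixed; rewrite // Ws.
  - rewrite !h0; have : c / 2 < c by lra.
    apply: lt_trans; apply: gn => //.
    have [r0 _ _] := pR; move: xy; rewrite /dprod/= r0 addr0 lt_min.
    by case/andP.
have [n [hh [K [n0 hhn [KB K0 K1 Ke]]]]] := apX _ _ _ _ _ e'0 pW cB hB.
have BA a t : A a -> itv01 t -> B (a, t) by left.
have BV z : V z -> B (z, 0) by right.
have [mh mh0 hhm] := hhn _ e'0.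
have [mg mg0 gm] := gV _ e'0.
(* [q] is the width of the collar of [A] in which the map is modified. *)
pose q := Num.min k (Num.min n (Num.min mh mg)).
have q0 : 0 < q by rewrite !lt_min k0 n0 mh0.
have [qk qn qh qg] : [/\ q <= k, q <= n, q <= mh & q <= mg].
  by rewrite /q; split; rewrite !ge_min lexx ?orbT.
pose t := setdist d A.
have tnear z : t z < q -> exists2 a, A a & d a z < q.
  by move/(setdist_lt pd A0).
(* With [t z / q] running from [1] to [0], [be] undoes [K] on [[1/2, 3/4]] and
   [al] climbs through [hh] on [[0, 1/4]]; on [[1/4, 1/2]] both stay at
   [hh (z, 0)], which leaves room for gluing. *)
pose la z := clamp (- 4 / q * t z + 1).
pose lb z := clamp (4 / q * t z + - 2).
have tq z c : (t z <= c * q) = (t z / q <= c) by rewrite ler_pdivrMr.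
have tq' z c : (c * q <= t z) = (c <= t z / q) by rewrite ler_pdivlMr.
pose al z := hh (z, la z).
pose be z := K ((z, 0), lb z).
have tnhd z s : t z < q -> itv01 s -> tube (dprod d dreal) B n (z, s).
  move=> /tnear[a Aa az] Is; exists (a, s); first exact: BA.
  by have [r0 _ _] := pR; rewrite /dprod/= r0 addr0; exact: lt_le_trans qn.
pose g' z := if t z <= 4^-1 * q then al z else be z.
exists g', (fun p => K ((p.1, 1), p.2)).
have be_ucont : ucont_on d V dX be.
  apply: (@ucont_on_comp _ _ _ _ _ _ _ (B `*` itv01) _
    (fun z => ((z, 0), lb z)) K _ _ KB).
    by move=> z Vz; split; [exact: BV|exact: itv01_clamp].
  apply: ucont_on_pair.
    by apply: ucont_on_pair; [exact: ucont_on_id|exact: ucont_on_cst].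
  by apply: ucont_on_affine_clamp; exact: setdist_ucont_on.
have al_ucont : ucont_on d (V `&` [set z | t z <= 2^-1 * q]) dX al.
  apply: (@ucont_on_comp _ _ _ _ _ _ _ (tube (dprod d dreal) B n) _
    (fun z => (z, la z)) hh _ _ hhn).
    by move=> z [Vz /= tz]; apply: tnhd; [lra|exact: itv01_clamp].
  apply: ucont_on_pair; first exact: ucont_on_id.
  by apply: ucont_on_affine_clamp; exact: setdist_ucont_on.
have seam z : V z -> 4^-1 * q <= t z <= 2^-1 * q -> al z = be z.
  move=> Vz /andP[]; rewrite tq tq' => z4 z2.
  rewrite /al /be /la /lb !clamp_le0; first by rewrite K0//; exact: BV.
    by rewrite mulrAC -mulrA; lra.
  by rewrite mulrAC -mulrA; lra.
have be_far z : V z -> dX (be z) (g z) <= e'.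
  by move=> Vz; rewrite -h0; apply: Ke; [exact: BV|exact: itv01_clamp].
have al_near z : V z -> t z < q -> dX (al z) (g z) <= 2 * e + 3 * e'.
  move=> Vz zq; have [a Aa az] := tnear _ zq.
  have Is := itv01_clamp (- 4 / q * t z + 1); rewrite -/(la z) in Is.
  have s1 : dX (hh (z, la z)) (hh (a, la z)) < e'.
    rewrite dXs; apply: hhm.
    - apply: sub_tube => //; exact: BA.
    - exact: tnhd.
    - have [r0 _ _] := pR; rewrite /dprod/= r0 addr0.
      exact: lt_le_trans qh.
  have s2 : dX (hh (a, la z)) (H (a, la z)) <= e'.
    rewrite -hH// -K0; last exact: BA.
    by apply: Ke; [exact: BA|exact: itv01_0].
  have s3 := He a (la z) Aa Is.
  have s4 := He a 0 Aa itv01_0; rewrite H0// dXs in s4.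
  have s5 : dX (g a) (g z) < e' by apply: gm => //; [exact: AV|exact: lt_le_trans qg].
  have := dXt (hh (z, la z)) (hh (a, la z)) (g z).
  have := dXt (hh (a, la z)) (H (a, la z)) (g z).
  have := dXt (H (a, la z)) (f a) (g z).
  have := dXt (f a) (g a) (g z).
  by rewrite /al; lra.
split.
- apply: (@ucont_on_glue _ _ _ _ _ _ t (4^-1 * q) (2^-1 * q)) => //.
  + by lra.
  + exact: setdist_ucont_on.
  + by apply: ucont_onS be_ucont => z [].
- split=> [|a Aa|a Aa|a s Aa Is] /=.
  + apply: (@ucont_on_comp _ _ _ _ _ _ _ (B `*` itv01) _
      (fun p => ((p.1, 1), p.2)) K _ _ KB).
      by move=> [a s] [/= Aa Is]; split => //; apply: BA => //; exact: itv01_1.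
    apply: ucont_on_pair; last exact: ucont_on_snd.
    by apply: ucont_on_pair; [exact: ucont_on_fst|exact: ucont_on_cst].
  + rewrite K0; last by apply: BA => //; exact: itv01_1.
    have ta : t a = 0 by exact: setdist_in.
    rewrite /g' ta ifT; last by lra.
    by rewrite /al /la ta mulr0 add0r clamp_id// ler01 lexx.
  + by rewrite K1; [rewrite hH// H1|apply: BA => //; exact: itv01_1].
  + rewrite -(H1 _ Aa) -hH//; apply: Ke => //; apply: BA => //; exact: itv01_1.
- move=> z Vz nz; have zk : k <= t z.
    by rewrite leNgt; apply/negP => /(setdist_lt pd A0).
  rewrite /g' ifF; last by apply/negbTE; rewrite -ltNge; lra.
  rewrite /be /lb clamp_ge1; first by rewrite K1; [exact: h0|exact: BV].
  have : 1 * q <= t z by lra.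
  by rewrite tq' mulrAC -mulrA; lra.
- move=> z Vz; rewrite /g'; case: (leP (t z)) => [zq|_].
    by apply: le_trans (al_near _ Vz _) _; lra.
  by apply: le_trans (be_far _ Vz) _; lra.
Qed.

End Improvement.
End Extensors.

(** * From approximate to exact extension *)

Section Limit.
Context {R : realType}.

Definition half_pow (n : nat) : R := 2^-1 ^+ n.

Lemma half_pow_gt0 n : 0 < half_pow n.
Proof. by rewrite exprn_gt0// invr_gt0. Qed.

Lemma half_powS n : half_pow n.+1 = half_pow n / 2.
Proof. by rewrite /half_pow exprSr. Qed.

Lemma half_pow_le n m : (n <= m)%N -> half_pow m <= half_pow n.
Proof.
move=> /subnK <-; elim: (m - n)%N => // k IH; rewrite addSn half_powS.
by have := half_pow_gt0 (k + n); lra.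
Qed.

Lemma half_pow_small (e : R) : 0 < e -> exists n, half_pow n < e.
Proof.
move=> e0; exists (Num.bound e^-1); rewrite /half_pow exprVn invf_plt ?posrE ?exprn_gt0//.
have /lt_trans : e^-1 < (Num.bound e^-1)%:R.
  by apply: archi_boundP; rewrite invr_ge0 ltW.
by apply; rewrite -natrX ltr_nat ltn_expl.
Qed.

(** Successive improvements with summable errors, supported in shrinking collars
    of [A], converge uniformly on a fixed neighborhood [V]; so the uniform
    continuity of the limit needs no control of the moduli of the stages. *)
Lemma approx_extensor_extensor (X : Type) (dX : X -> X -> R) :
  pseudometric dX -> (forall x y, dX x y = 0 -> x = y) ->
  approx_extensor dX -> extensor dX.
Proof.
move=> pX X0 apX W d A f pd cA fA.
have [A0|/set0P/negP/negPn/eqP Ae] := pselect (A !=set0); last first.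
  exists 1, f; split=> // e e0; exists 1 => // x y [a].
  by rewrite Ae.
have [_ dXs dXt] := pX.
(* The neighborhood must be closed for [improvement], hence the sublevel set. *)
have [k0 [g0 [H0 [k00 g0u H0h]]]] := apX 1 _ _ _ _ ltr01 pd cA fA.
pose V := [set z | setdist d A z <= k0 / 2].
have cV : dclosed d V by exact: dclosed_setdist_le.
have AV : A `<=` V by move=> a Aa; rewrite /V/= setdist_in//; lra.
have Vk0 : V `<=` tube d A k0.
  by move=> z; rewrite /V/= => zV; apply/(setdist_lt pd A0); lra.
pose state := ((W -> X) * (W * R -> X))%type.
pose inv n (s : state) :=
  ucont_on d V dX s.1 /\ homotopy_to d dX A (half_pow n) s.1 f s.2.
pose rel n (s s' : state) :=
  (forall z, V z -> ~ tube d A (half_pow n) z -> s'.1 z = s.1 z) /\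
  (forall z, V z -> dX (s'.1 z) (s.1 z) <= 5 * half_pow n).
have /choice[next nextP] : forall ns : nat * state, exists s',
    inv ns.1 ns.2 -> inv ns.1.+1 s' /\ rel ns.1 ns.2 s'.
  move=> [n [g H]] /=.
  have [/= [gu Hh]|ninv] := pselect (inv n (g, H)); last by exists (g, H).
  have [|||g' [H' [g'u Hh' far near]]] := improvement pX pd cA A0 cV AV
      (e' := half_pow n.+1) (k := half_pow n) apX _ _ _ gu Hh.
  - exact: half_pow_gt0.
  - exact: half_pow_le.
  - exact: half_pow_gt0.
  by exists (g', H').
pose s := nat_rect (fun=> state) (g0, H0) (fun n s => next (n, s)).
have sinv n : inv n (s n).
  elim: n => [|n IH]; last by have [] := nextP (n, s n) IH.
  by split => //=; exact: ucont_onS g0u.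
have srel n : rel n (s n) (s n.+1) by have [] := nextP (n, s n) (sinv n).
pose g n := (s n).1.
(* The sum of [5 * 2 ^- j] for [n <= j < m]. *)
have gcauchy n m z : (n <= m)%N -> V z ->
    dX (g m z) (g n z) <= 10 * half_pow n - 10 * half_pow m.
  move=> /subnK <- Vz; elim: (m - n)%N => [|j IH].
    by have [-> _ _] := pX; rewrite add0n subrr.
  have [_ near] := srel (j + n)%N.
  have := near z Vz; rewrite -/(g (j + n).+1) -/(g (j + n)%N) addSn half_powS.
  by have := dXt (g (j + n).+1 z) (g (j + n)%N z) (g n z); lra.
have gstable z : V z -> ~ A z -> exists N, forall n, (N <= n)%N -> g n z = g N z.
  move=> Vz nA; have z0 : 0 < setdist d A z.
    rewrite lt_neqAle setdist_ge0// andbT; apply/eqP => /esym z0.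
    by apply: nA; exact: (setdist_eq0 pd A0).
  have [N Nz] := half_pow_small z0; exists N => n /subnK <-.
  elim: (n - N)%N => // j <-; have [far _] := srel (j + N)%N.
  apply: (far z Vz) => /(setdist_lt pd A0) h.
  by have := half_pow_le (leq_addl j N); lra.
(* The limit is specified by its distance to every stage, which also determines
   it on [A], where [g n] tends to [f]. *)
have /choice[r rP] : forall z, exists x, V z ->
    forall n, dX x (g n z) <= 10 * half_pow n.
  move=> z; have [Vz|nV] := pselect (V z); last by exists (f z).
  have [Az|nA] := pselect (A z).
    exists (f z) => _ n; have [_ [_ H1 _ He]] := sinv n.
    have := He z 0 Az itv01_0; rewrite H1// -/(g n) dXs.
    by have := half_pow_gt0 n; lra.
  have [N gN] := gstable z Vz nA; exists (g N z) => _ n.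
  have [nN|/ltnW Nn] := leqP n N.
    by have := gcauchy n N z nN Vz; have := half_pow_gt0 N; lra.
  rewrite (gN n Nn); have [-> _ _] := pX.
  by have := half_pow_gt0 n; lra.
exists (k0 / 2), r; split.
- by lra.
- apply: (@ucont_onS _ _ _ _ _ V) => [z /(setdist_lt pd A0)/ltW//|].
  move=> e e0; have [n en] := half_pow_small (ltac:(lra) : 0 < e / 30).
  have [gu _] := sinv n.
  have [k k00' gk] := gu _ (ltac:(lra) : 0 < e / 3).
  exists k => // x y Vx Vy xy; have := gk x y Vx Vy xy.
  rewrite -/(g n); have := rP x Vx n; have := rP y Vy n.
  rewrite (dXs (r y)); have := dXt (r x) (g n x) (r y).
  by have := dXt (g n x) (g n y) (r y); lra.
- move=> a Aa; apply: X0; apply/eqP; rewrite eq_le pseudometric_ge0// andbT.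
  rewrite leNgt; apply/negP => h.
  have [n en] := half_pow_small (ltac:(lra) : 0 < dX (r a) (f a) / 11).
  have [_ [_ H1 _ He]] := sinv n.
  have := He a 0 Aa itv01_0; rewrite H1// -/(g n).
  have := rP a (AV _ Aa) n; have := dXt (r a) (g n a) (f a); lra.
Qed.

End Limit.

(** * Metrizable uniform spaces in terms of a compatible metric *)

Section Translation.
Context {R : realType}.

Definition dsub (T : Type) (A : set T) (d : T -> T -> R) (x y : A) : R :=
  d (set_val x) (set_val y).

Lemma compatible_pseudometric (Z : uniformType) (d : Z -> Z -> R) :
  compatible_metric d -> pseudometric d.
Proof. by move=> [d0 ds dt _]; split=> // x; apply/d0. Qed.

Lemma compatible_entourageP (Z : uniformType) (d : Z -> Z -> R)
    (E : set (Z * Z)) : compatible_metric d ->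
  entourage E <-> exists2 e, 0 < e & forall x y, d x y < e -> E (x, y).
Proof.
move=> [_ _ _ ->]; split=> -[e e0 eE]; exists e => //.
  by move=> x y xy; exact: (eE (x, y)).
by move=> [x y] /= xy; exact: eE.
Qed.

Lemma compatibleI (Z : uniformType) (d : Z -> Z -> R) :
  pseudometric d -> (forall x y, d x y = 0 -> x = y) ->
  (forall E : set (Z * Z), entourage E <->
    exists2 e, 0 < e & forall x y, d x y < e -> E (x, y)) ->
  compatible_metric d.
Proof.
move=> [d0 ds dt] dI dE; split=> //.
  by move=> x y; split=> [/dI//|->].
apply/seteqP; split=> E; first by move/dE => -[e e0 eE]; exists e => // -[x y]/eE.
by move=> [e e0 eE]; apply/dE; exists e => // x y xy; exact: (eE (x, y)).
Qed.

Lemma unif_continuousE (S T : uniformType) (dS : S -> S -> R)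
    (dT : T -> T -> R) (f : S -> T) :
  compatible_metric dS -> compatible_metric dT ->
  unif_continuous f <-> ucont_on dS setT dT f.
Proof.
move=> cS cT; split=> [fu e e0|fu E].
  have /fu/(compatible_entourageP _ cS)[k k0 kE] :
      entourage [set p : T * T | dT p.1 p.2 < e].
    by apply/(compatible_entourageP _ cT); exists e.
  by exists k => // x y _ _ xy; exact: (kE _ _ xy).
move/(compatible_entourageP _ cT) => [e e0 eE].
have [k k0 fk] := fu _ e0.
by apply/(compatible_entourageP _ cS); exists k => // x y xy; apply: eE; exact: fk.
Qed.

Lemma closed_dclosedE (Z : uniformType) (d : Z -> Z -> R) (A : set Z) :
  compatible_metric d -> closed A <-> dclosed d A.
Proof.
move=> cd; have [_ ds _] := compatible_pseudometric cd.
suff clE z : closure A z <-> forall e, 0 < e -> tube d A e z.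
  by split=> cA z; [move/clE/cA|move/clE; exact: cA].
split=> [clz e e0|tz B].
  have /clz[a [Aa /= za]] : nbhs z [set y | d z y < e].
    rewrite -nbhs_entourageE; exists [set p | d p.1 p.2 < e].
      by apply/(compatible_entourageP _ cd); exists e.
    by move=> y /xsectionP.
  by exists a; rewrite // ds.
rewrite -nbhs_entourageE => -[E /(compatible_entourageP _ cd)[e e0 eE] EB].
have [a Aa az] := tz e e0; exists a; split => //.
by apply: EB; apply/xsectionP; apply: eE; rewrite ds.
Qed.

Lemma compatible_dprod (S T : uniformType) (dS : S -> S -> R)
    (dT : T -> T -> R) : compatible_metric dS -> compatible_metric dT ->
  compatible_metric (dprod dS dT).
Proof.
move=> cS cT; have pS := compatible_pseudometric cS.
have pT := compatible_pseudometric cT.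
apply: compatibleI => [|[x y] [x' y']|E].
- exact: dprod_pseudometric.
- rewrite /dprod/= => h; have := pseudometric_ge0 pS x x'.
  have := pseudometric_ge0 pT y y'; case: cS => [S0 _ _ _]; case: cT => [T0 _ _ _].
  by move=> ? ?; congr (_, _); [apply/S0|apply/T0]; lra.
split.
  move=> [[A B] /= [/(compatible_entourageP _ cS)[a a0 aA]
      /(compatible_entourageP _ cT)[b b0 bB]] ABE].
  exists (Num.min a b); first by rewrite lt_min a0.
  move=> [x y] [x' y']; rewrite /dprod/= lt_min => /andP[xa xb].
  have /ABE[[[p1 p2] [p3 p4]] /= h [<- <- <- <-]] : (A `*` B) ((x, x'), (y, y')).
    split=> /=; [apply: aA|apply: bB].
      by have := pseudometric_ge0 pT y y'; lra.
    by have := pseudometric_ge0 pS x x'; lra.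
  exact: h.
move=> [e e0 eE].
have eA : entourage [set p : S * S | dS p.1 p.2 < e / 2].
  by apply/(compatible_entourageP _ cS); exists (e / 2); rewrite ?divr_gt0.
have eB : entourage [set p : T * T | dT p.1 p.2 < e / 2].
  by apply/(compatible_entourageP _ cT); exists (e / 2); rewrite ?divr_gt0.
apply: filterS (prod_entP eA eB) => -[[x y] [x' y']] /= [h1 h2].
by apply: eE; rewrite /dprod/=; lra.
Qed.

Lemma compatible_dsub (Z : uniformType) (A : set Z) (d : Z -> Z -> R) :
  compatible_metric d -> compatible_metric (@dsub Z A d).
Proof.
move=> cd; have [d0 ds dt] := compatible_pseudometric cd.
apply: compatibleI => [|x y xy|E].
- by split=> [x|x y|x y z]; [exact: d0|exact: ds|exact: dt].
- by apply: val_inj; rewrite -set_valE; case: cd => [D _ _ _]; apply/D.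
split.
  move=> [B /(compatible_entourageP _ cd)[e e0 eB] BE].
  by exists e => // x y xy; apply: BE; exact: eB.
move=> [e e0 eE]; exists [set p | d p.1 p.2 < e].
  by apply/(compatible_entourageP _ cd); exists e.
by move=> [x y] xy; exact: eE.
Qed.

Lemma compatible_dreal : compatible_metric (@dreal R).
Proof.
split=> [x y|x y|x y z|].
- by rewrite /dreal; split=> [/normr0_eq0/eqP|->]; rewrite ?subr_eq0 ?subrr ?normr0// => /eqP.
- by have [_ + _] := @dreal_pseudometric R.
- by have [_ _ +] := @dreal_pseudometric R.
- by rewrite -entourage_ballE.
Qed.

Lemma compatible_mdist (X : metricType R) :
  compatible_metric (@mdist R X : X -> X -> R).
Proof.
split=> [x y|x y|x y z|].
- by split=> [/mdist_positivity//|->]; exact: mdistxx.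
- exact: metric_sym.
- exact: metric_triangle.
- by rewrite -entourage_ballE; congr entourage_; apply/funext => x;
    apply/funext => e; rewrite ballEmdist.
Qed.

(** A copy of [T] indexed by the metric axioms, so that canonical instances can
    attach to it the uniformity of [d]. *)
Definition metric_carrier (T : Type) (d : T -> T -> R) (pd : pseudometric d)
  (d0 : forall x y, d x y = 0 -> x = y) : Type := T.

Section MetricCarrier.
Context (T : Type) (d : T -> T -> R) (pd : pseudometric d).
Context (d0 : forall x y, d x y = 0 -> x = y).

HB.instance Definition _ := gen_eqMixin (metric_carrier pd d0).
HB.instance Definition _ := gen_choiceMixin (metric_carrier pd d0).

Let dxx x : d x x = 0. Proof. by case: pd. Qed.
Let dsym x y : d x y = d y x. Proof. by case: pd. Qed.
Let dtri y x z : d x z <= d x y + d y z. Proof. by case: pd. Qed.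

HB.instance Definition _ := @isMetric.Build R (metric_carrier pd d0)
  d dxx d0 dsym dtri.

Lemma compatible_metric_carrier :
  compatible_metric (d : metric_carrier pd d0 -> metric_carrier pd d0 -> R).
Proof. exact: compatible_mdist. Qed.

End MetricCarrier.

End Translation.

(** * Uniform ANRs and extension of maps *)

Section UniformANR.
Context {R : realType}.

Lemma unif_embeddingE (Y Z : uniformType) (dY : Y -> Y -> R) (dZ : Z -> Z -> R)
    (i : Y -> Z) : compatible_metric dY -> compatible_metric dZ ->
  unif_embedding i <-> ucont_on dY setT dZ i /\
    forall e, 0 < e -> exists2 k, 0 < k &
      forall x y, dZ (i x) (i y) < k -> dY x y < e.
Proof.
move=> cY cZ; split.
  move=> [iu [g [gu ig gi]]]; split; first exact/unif_continuousE.
  move=> e e0; have /(unif_continuousE _ (compatible_dsub _ cZ) cY) := gu.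
  move=> /(_ _ e0)[k k0 gk]; exists k => // x y xy.
  by rewrite -[x]ig -[y]ig; apply: gk.
move=> [iu ik]; split; first exact/(unif_continuousE _ cY cZ).
have pick (u : range i) : {y | i y = set_val u}.
  by apply: cid; have [y _ yu] := set_valP u; exists y.
have inj x y : i x = i y -> x = y.
  move=> ixy; case: (cY) => [D _ _ _]; apply/D.
  have pY := compatible_pseudometric cY.
  apply/eqP; rewrite eq_le pseudometric_ge0// andbT leNgt; apply/negP => h.
  have [k k0 kxy] := ik _ h; have := kxy x y; rewrite ixy.
  by have [-> _ _] := compatible_pseudometric cZ; move=> /(_ k0); rewrite ltxx.
exists (fun u => sval (pick u)); split.
- apply/(unif_continuousE _ (compatible_dsub _ cZ) cY) => e /ik[k k0 kxy].
  by exists k => // u v _ _ uv; apply: kxy; rewrite !(svalP (pick _)).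
- by move=> y; apply: inj; rewrite (svalP (pick _)).
- by move=> u; apply: val_inj; rewrite /= (svalP (pick _)).
Qed.

Lemma ucont_on_compatible (S : Type) (T : uniformType) (dS : S -> S -> R)
    (dT dT' : T -> T -> R) (A : set S) (f : S -> T) :
  compatible_metric dT -> compatible_metric dT' ->
  ucont_on dS A dT f -> ucont_on dS A dT' f.
Proof.
move=> cT cT' fA; apply: (@ucont_on_comp _ _ _ _ _ _ _ setT _ f id _ fA) => //.
by apply/(unif_continuousE _ cT cT') => E; apply: filterS => -[].
Qed.

(** A retraction onto a closed copy of [X] is an extension of the inverse of the
    embedding.  An empty [X] is treated apart, as that inverse is made total by
    choosing a point of [X]. *)
Lemma extensor_unif_ANR (X : uniformType) (dX : X -> X -> R) :
  compatible_metric dX -> extensor dX -> unif_ANR R X.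
Proof.
move=> cX eX; split; first by exists dX.
move=> Z i [d cd] /(unif_embeddingE _ cX cd)[iu ik] /(closed_dclosedE _ cd) cl.
have [[x0 _]|X0] := pselect (exists x : X, True); last first.
  have i0 z : ~ range i z by move=> [x _ _]; apply: X0; exists x.
  exists set0; first by exists d => //; exists 1 => // z [y /i0].
  exists (fun u : (set0 : set Z) => False_rect _ (set_valP u)); split.
    by apply/(unif_continuousE _ (compatible_dsub _ cd) (compatible_dsub _ cd)) =>
      e e0; exists 1 => // u; case: (set_valP u).
  by move=> u; case: (set_valP u).
have /choice[f fP] : forall z, exists x, range i z -> i x = z.
  move=> z; have [[x _ xz]|nz] := pselect (range i z); first by exists x.
  by exists x0.
have fu : ucont_on d (range i) dX f.
  move=> e /ik[k k0 kxy]; exists k => // y z iy iz yz.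
  by apply: kxy; rewrite !fP.
have [k [g [k0 gu gf]]] := eX _ _ _ _ (compatible_pseudometric cd) cl fu.
exists (tube d (range i) k); first by exists d => //; exists k.
exists (corestrict (range_mem i) \o g \o set_val); split; last first.
  move=> u Au; have E : i (g (set_val u)) = set_val u by rewrite gf// fP.
  exact: E.
apply/(unif_continuousE _ (compatible_dsub _ cd) (compatible_dsub _ cd)).
apply: (@ucont_on_comp _ _ _ _ _ _ _ setT _ (g \o set_val) _ _ _ iu) => //.
apply: (@ucont_on_comp _ _ _ _ _ _ _ _ _ set_val _ _ _ gu).
  by move=> u _; exact: set_valP.
by move=> e e0; exists e.
Qed.

(** [rho] is [omega o d], where [omega] is the infimum of the affine functions
    [t |-> c + L * t] that bound the modulus of [f] on [A].  It is a concave
    modulus of continuity, and concavity gives the triangle inequality.  Since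
    [dY <= 1], such affine bounds exist with [c] as small as desired. *)
Lemma lipschitz_majorant (W Y : Type) (d : W -> W -> R) (dY : Y -> Y -> R)
    (A : set W) (f : W -> Y) :
  pseudometric d -> (forall x y, dY x y <= 1) -> ucont_on d A dY f ->
  exists rho : W -> W -> R,
    [/\ pseudometric rho,
        forall e, 0 < e -> exists2 k, 0 < k &
          forall x y, d x y < k -> rho x y < e &
        forall a b, A a -> A b -> dY (f a) (f b) <= rho a b].
Proof.
move=> pd d1 fA; have [d0 ds dt] := pd; have dge0 := pseudometric_ge0 pd.
pose adm : set (R * R) := [set p | [/\ 0 <= p.1, 0 <= p.2 &
  forall a b, A a -> A b -> dY (f a) (f b) <= p.1 + p.2 * d a b]].
pose rho x y := infon adm (fun p => p.1 + p.2 * d x y).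
have adm0 : adm !=set0.
  by exists (1, 0); split => //= a b _ _; rewrite mul0r addr0.
have rho_le p x y : adm p -> rho x y <= p.1 + p.2 * d x y.
  move=> admp; apply: (@infon_le _ _ adm (fun p => p.1 + p.2 * d x y)) => //.
  by move=> q [q1 q2 _]; rewrite addr_ge0// mulr_ge0.
have rho_small e : 0 < e -> exists2 k, 0 < k &
    forall x y, d x y < k -> rho x y < e.
  move=> e0; have e20 : 0 < e / 2 by lra.
  have [k k0 fk] := fA _ e20; exists (k * (e / 2)); first exact: mulr_gt0.
  move=> x y xy; have /rho_le/le_lt_trans : adm (e / 2, k^-1).
    split => /=; [lra|by rewrite invr_ge0 ltW|move=> a b Aa Ab].
    have [ab|ab] := ltP (d a b) k.
      have := fk a b Aa Ab ab.
      by have : 0 <= k^-1 * d a b; [rewrite mulr_ge0// invr_ge0 ltW|lra].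
    have : 1 <= k^-1 * d a b by rewrite mulrC ler_pdivlMr// mul1r.
    by have := d1 (f a) (f b); lra.
  apply; rewrite /=; have : k^-1 * d x y < e / 2 by rewrite mulrC ltr_pdivrMr// mulrC.
  lra.
have rho_ge0 x y : 0 <= rho x y.
  by apply: le_infon => // p [p1 p2 _]; rewrite addr_ge0// mulr_ge0.
exists rho; split=> //.
- split=> [x|x y|x y z].
  + apply/eqP; rewrite eq_le rho_ge0 andbT leNgt; apply/negP => h.
    by have [k k0 /(_ x x)] := rho_small _ h; rewrite d0 ltxx => /(_ k0).
  + by rewrite /rho ds.
  + rewrite -lerBlDr; apply: le_infon => // p admp.
    rewrite lerBlDr addrC -lerBlDr; apply: le_infon => // q admq.
    rewrite lerBlDr; have [p1 p2 _] := admp; have [q1 q2 _] := admq.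
    have [pq|/ltW pq] := leP p.2 q.2.
      apply: (le_trans (rho_le p _ _ admp)).
      have := ler_wpM2l p2 (dt x y z); have := ler_wpM2r (dge0 y z) pq.
      by rewrite mulrDr; lra.
    apply: (le_trans (rho_le q _ _ admq)).
    have := ler_wpM2l q2 (dt x y z); have := ler_wpM2r (dge0 x y) pq.
    by rewrite mulrDr; lra.
- by move=> a b Aa Ab; apply: le_infon => // p [_ _]; exact.
Qed.

(** The truncated sup distance is finite on all functions, bounded or not. *)
Section FunctionDistance.
Context {Y : Type} (y0 : Y).

Definition fundist (phi psi : Y -> R) : R :=
  sup [set Num.min 1 `|phi y - psi y| | y in setT].

Lemma fundist_ge phi psi y : Num.min 1 `|phi y - psi y| <= fundist phi psi.
Proof.
apply: ub_le_sup; last by exists y.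
by exists 1 => _ [z _ <-]; rewrite ge_min lexx.
Qed.

Lemma fundist_le phi psi c :
  (forall y, Num.min 1 `|phi y - psi y| <= c) -> fundist phi psi <= c.
Proof.
move=> h; apply: ge_sup; first by exists (Num.min 1 `|phi y0 - psi y0|), y0.
by move=> _ [y _ <-].
Qed.

Lemma fundist_pseudometric : pseudometric fundist.
Proof.
split=> [phi|phi psi|phi psi chi].
- apply/eqP; rewrite eq_le; apply/andP; split.
    by apply: fundist_le => y; rewrite subrr normr0 ge_min lexx orbT.
  apply: le_trans (fundist_ge phi phi y0).
  by rewrite subrr normr0 le_min ler01 lexx.
- by congr sup; apply: eq_imagel => y _; rewrite distrC.
- apply: fundist_le => y; have := fundist_ge phi psi y.
  have := fundist_ge psi chi y.
  have := ler_normD (phi y - psi y) (psi y - chi y).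
  rewrite addrA subrK.
  have := normr_ge0 (phi y - psi y); have := normr_ge0 (psi y - chi y).
  set a := `|_|; set b := `|_|; set c := `|_| => ? ? ?.
  rewrite /Num.min; case: (ltP 1 a); case: (ltP 1 b); case: (ltP 1 c); lra.
Qed.

Lemma fundist_eq0 phi psi : fundist phi psi = 0 -> phi = psi.
Proof.
move=> h; apply/funext => y; apply/eqP; rewrite -subr_eq0 -normr_eq0.
rewrite eq_le normr_ge0 andbT.
by have := fundist_ge phi psi y; rewrite h ge_min; case/orP => //; lra.
Qed.

(** The Kuratowski embedding is isometric; the truncation is harmless for a
    pseudometric bounded by [1]. *)
Lemma fundist_kuratowski (d : Y -> Y -> R) x y : pseudometric d ->
  (forall x y, d x y <= 1) -> fundist (d x) (d y) = d x y.
Proof.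
move=> pd d1; have [d0 ds dt] := pd; apply/eqP; rewrite eq_le; apply/andP; split.
  apply: fundist_le => z; rewrite ge_min; apply/orP; right.
  rewrite ler_norml; have := dt x y z; have := dt y x z.
  by rewrite (ds y x); lra.
have := fundist_ge (d x) (d y) y; apply: le_trans.
by rewrite d0 subr0 le_min d1 ler_norm.
Qed.

End FunctionDistance.
End UniformANR.

Section ANRExtensor.
Context {R : realType}.

Lemma compatible_bounded (Z : uniformType) (d : Z -> Z -> R) :
  compatible_metric d -> compatible_metric (fun x y => Num.min 1 (d x y)).
Proof.
move=> cd; have pd := compatible_pseudometric cd; have [d0 ds dt] := pd.
have dge0 := pseudometric_ge0 pd.
apply: compatibleI => [|x y|E].
- split=> [x|x y|x y z].
  + by rewrite d0; apply/min_idPr.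
  + by rewrite ds.
  + have := dt x y z; have := dge0 x y; have := dge0 y z.
    rewrite /Num.min; move: (d x y) (d y z) (d x z) => a b c.
    by case: (ltP 1 a); case: (ltP 1 b); case: (ltP 1 c); lra.
- case: cd => [D _ _ _] h; apply/D; move: h.
  by rewrite /Num.min; case: (ltP 1 (d x y)) => // _ /eqP; rewrite oner_eq0.
split=> [/(compatible_entourageP _ cd)[e e0 eE]|[e e0 eE]].
  exists (Num.min 1 e); first by rewrite lt_min ltr01.
  move=> x y xy; apply: eE; move: xy.
  rewrite /Num.min; case: (ltP 1 (d x y)) => ?; case: (ltP 1 e) => ?; lra.
apply/(compatible_entourageP _ cd); exists e => // x y xy; apply: eE.
by rewrite gt_min xy orbT.
Qed.

(** [Q] is the Kuratowski model of [Y] at height [0], together with all functions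
    at nonzero heights.  The map [F z] has the McShane extension [phi z] of the
    map [f] followed by the Kuratowski embedding as its first coordinate, and
    the distance from [z] to [A] as its second: a point of height [0] comes
    from [A] because [A] is closed, so [F] does take values in [Q].  The
    neighborhood retraction of [Q] onto [Y] is then applied to [F]. *)
Lemma unif_ANR_extensor (Y : uniformType) (dY : Y -> Y -> R) :
  compatible_metric dY -> unif_ANR R Y -> extensor dY.
Proof.
move=> cY [_ retY] W d A f pd cA fA.
have [A0|/set0P/negP/negPn/eqP Ae] := pselect (A !=set0); last first.
  exists 1, f; split=> // e e0; exists 1 => // x y [a].
  by rewrite Ae.
have [a0 Aa0] := A0; pose y0 := f a0.
pose d1 x y := Num.min 1 (dY x y).
have c1 : compatible_metric d1 by exact: compatible_bounded.
have p1 := compatible_pseudometric c1; have [d10 d1s d1t] := p1.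
have d1_le1 x y : d1 x y <= 1 by rewrite ge_min lexx.
have d1_ge0 := pseudometric_ge0 p1.
have f1 : ucont_on d A d1 f by exact: (ucont_on_compatible cY).
have [rho [prho rho_small rho_f]] := lipschitz_majorant pd d1_le1 f1.
have [rho0 rhos rhot] := prho; have rho_ge0 := pseudometric_ge0 prho.
pose Qset : set ((Y -> R) * R) := [set p | p.2 <> 0 \/ exists y, p.1 = d1 y].
pose dQ : Qset -> Qset -> R := dsub (dprod (@fundist R Y) (@dreal R)).
have pprod : pseudometric (dprod (@fundist R Y) (@dreal R)).
  apply: dprod_pseudometric; last exact: dreal_pseudometric.
  exact: fundist_pseudometric.
have pQ : pseudometric dQ.
  by have [q0 qs qt] := pprod; split=> [x|x y|x y z]; [exact: q0|exact: qs|exact: qt].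
have Q0 x y : dQ x y = 0 -> x = y.
  move=> h; apply: val_inj; rewrite -!set_valE.
  move: h; rewrite /dQ /dsub /dprod.
  have := pseudometric_ge0 (fundist_pseudometric y0) (set_val x).1 (set_val y).1.
  have := pseudometric_ge0 (@dreal_pseudometric R) (set_val x).2 (set_val y).2.
  move: (set_val x) (set_val y) => [p s] [p' s'] /= ? ? h.
  congr (_, _); first by apply: fundist_eq0; lra.
  by case: (@compatible_dreal R) => [D _ _ _]; apply/D; lra.
pose Q : uniformType := metric_carrier pQ Q0.
have cQ : compatible_metric (dQ : Q -> Q -> R) by exact: compatible_metric_carrier.
have kurQ y : Qset (d1 y, 0) by right; exists y.
pose i (y : Y) : Q := SigSub (mem_set (kurQ y)) : Qset.
have iE x y : dQ (i x) (i y) = d1 x y.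
  have [r0 _ _] := @dreal_pseudometric R.
  rewrite /dQ /dsub /dprod [X in _ + X](r0 0) addr0.
  exact: fundist_kuratowski.
have iemb : unif_embedding i.
  apply/(unif_embeddingE _ c1 cQ); split=> e e0; exists e => // x y.
    by move=> _ _; rewrite iE.
  by rewrite iE.
have iclosed : closed (range i).
  apply/(closed_dclosedE _ cQ) => q qi.
  have q2 : (set_val q).2 = 0.
    apply/eqP; rewrite -normr_eq0 eq_le normr_ge0 andbT leNgt; apply/negP => h.
    have [_ [y _ <-]] := qi _ h; rewrite /dQ /dsub /dprod/=.
    have := pseudometric_ge0 (fundist_pseudometric y0) (d1 y) (set_val q).1.
    rewrite /dreal set_valE /= sub0r normrN => ?; lra.
  have [] := set_valP q; first by rewrite q2.
  move=> [y qy]; exists y => //; apply: val_inj; rewrite -!set_valE.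
  by rewrite [set_val q]surjective_pairing qy q2.
have mQ : unif_metrizable R Q by exists dQ.
have [U /(unif_nbhdP _ _ cQ)[e e0 eU] [r [ru rid]]] :=
  retY _ _ mQ iemb iclosed.
pose phi z y := infon A (fun a => d1 (f a) y + rho a z).
have phi_ge0 y z a : A a -> 0 <= d1 (f a) y + rho a z.
  by move=> _; rewrite addr_ge0.
have phiA a : A a -> phi a = d1 (f a).
  move=> Aa; apply/funext => y; apply/eqP; rewrite eq_le; apply/andP; split.
    have := infon_le (phi_ge0 y a) Aa.
    by rewrite rho0 addr0.
  apply: le_infon => // b Ab.
  by have := d1t (f a) (f b) y; have := rho_f a b Aa Ab; rewrite (rhos a b); lra.
have phi_lip z z' y : `|phi z y - phi z' y| <= rho z z'.
  have lip u v : phi u y <= phi v y + rho u v.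
    apply: infon_lip => // [b Ab|b Ab]; first exact: phi_ge0.
    by have := rhot b v u; rewrite (rhos v u); lra.
  by rewrite ler_norml; have := lip z z'; have := lip z' z; rewrite (rhos z' z); lra.
have FQ z : Qset (phi z, setdist d A z).
  have [z0|z0] := pselect (setdist d A z = 0); last by left.
  have Az : A z by exact: (setdist_eq0 pd A0).
  by right; exists (f z); rewrite /= phiA.
pose F z : Q := SigSub (mem_set (FQ z)) : Qset.
have FA a : A a -> F a = i (f a).
  by move=> Aa; apply: val_inj => /=; rewrite phiA// setdist_in.
have FF z z' : dQ (F z) (F z') <= rho z z' + d z z'.
  rewrite /dQ /dsub /dprod; apply: lerD; last exact: setdist_lip.
  by apply: fundist_le => // y; rewrite ge_min phi_lip orbT.
have Fu c : 0 < c -> exists2 k, 0 < k & forall z z', d z z' < k -> dQ (F z) (F z') < c.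
  move=> c0; have c20 : 0 < c / 2 by lra.
  have [k k0 kr] := rho_small _ c20.
  exists (Num.min k (c / 2)); first by rewrite lt_min k0.
  move=> z z'; rewrite lt_min => /andP[/kr zr zd].
  by have := FF z z'; lra.
have /choice[g gP] : forall z, exists y, forall u : U,
    set_val u = F z -> i y = set_val (r u).
  move=> z; have [Uz|nU] := pselect (U (F z)); last first.
    by exists y0 => u uz; case: nU; rewrite -uz; exact: set_valP.
  pose uz : U := SigSub (mem_set Uz).
  have [y _ yr] := set_valP (r uz); exists y => u uF.
  by rewrite yr; congr (set_val (r _)); apply: val_inj; rewrite -!set_valE uF.
have [k k0 kF] := Fu _ e0.
have tU z : tube d A k z -> exists u : U, set_val u = F z.
  move=> [a Aa az]; have Uz : U (F z).
    apply: eU; exists (i (f a)); first by exists (f a).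
    by rewrite -FA//; exact: kF.
  by exists (SigSub (mem_set Uz)).
exists k, g; split=> //.
  apply: (ucont_on_compatible c1 cY) => c c0.
  have /(unif_continuousE _ (compatible_dsub _ cQ) (compatible_dsub _ cQ)) := ru.
  move=> /(_ _ c0)[m m0 rm]; have [n n0 Fn] := Fu _ m0.
  exists n => // x y /tU[u uE] /tU[v vE] xy.
  rewrite -iE (gP _ _ uE) (gP _ _ vE); apply: rm => //.
  by rewrite /dsub uE vE; exact: Fn.
move=> a Aa; have [u uE] := tU a (sub_tube pd k0 Aa).
have ria : range i (set_val u) by rewrite uE FA//; exists (f a).
have h : i (g a) = i (f a) by rewrite (gP _ _ uE) rid// uE FA.
have [D _ _ _] := c1; have [q0 _ _] := pQ.
by apply/D; rewrite -iE h; exact: q0.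
Qed.

End ANRExtensor.

(** * Domination, embeddings and the theorem *)

Section Domination.
Context {R : realType}.

(** The factor [2] comes from measuring closeness at the other end of the
    homotopy. *)
Lemma eps_homotopic_homotopy_to (X : metricType R) (e : R) (phi : X -> X)
    (W : Type) (d : W -> W -> R) (A : set W) (f : W -> X) :
  pseudometric d -> unif_eps_homotopic e phi idfun ->
  ucont_on d A (@mdist R X) f ->
  exists K, homotopy_to d (@mdist R X) A (2 * e) (phi \o f) f K.
Proof.
move=> pd [H [Hu H0 H1 He]] fA.
have cX := compatible_mdist X.
have cI := compatible_dsub (@unit_itv R) (@compatible_dreal R).
move/(unif_continuousE _ (compatible_dprod cX cI) cX) : Hu => Hu.
have clI t : @unit_itv R (clamp t).
  by rewrite /unit_itv/= in_itv/=; exact: clamp_itv.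
pose cl t : @unit_itv R := SigSub (mem_set (clI t)).
have cl0 : cl 0 = I0 by apply: val_inj; rewrite /= clamp_le0.
have cl1 : cl 1 = I1 by apply: val_inj; rewrite /= clamp_ge1.
exists (fun p => H (f p.1, cl p.2)); split=> [|a Aa|a Aa|a t Aa It] /=.
- apply: (@ucont_on_comp _ _ _ _ _ _ _ _ _ (fun p => (f p.1, cl p.2)) _ _ _ Hu) => //.
  apply: ucont_on_pair.
    apply: (@ucont_on_comp _ _ _ _ _ _ _ _ _ fst _ _ _ fA).
      by move=> p [].
    by apply: ucont_on_fst; exact: dreal_pseudometric.
  apply: (@lip_ucont_on _ _ _ _ _ _ _ 1) => // p q _ _; rewrite mul1r.
  apply: (@le_trans _ _ (dreal p.2 q.2)); first exact: clamp_lip.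
  by rewrite /dprod lerDr; exact: pseudometric_ge0.
- by rewrite cl0 H0.
- by rewrite cl1 H1.
- have := He (f a, cl t); have := He (f a, I1); rewrite H1/=.
  have := metric_triangle (H (f a, cl t)) (phi (f a)) (f a).
  by rewrite (metric_sym (f a)); lra.
Qed.

Lemma dominated_approx_extensor (X : metricType R) :
  (forall e : R, 0 < e ->
    exists2 Y : uniformType, unif_ANR R Y & unif_eps_dominated e X Y) ->
  approx_extensor (@mdist R X).
Proof.
move=> dom e W d A f e0 pd cA fA.
have [Y aY [u [v [uu vu vuh]]]] := dom _ (ltac:(lra) : 0 < e / 2).
have [[dY cY] _] := aY; have cX := compatible_mdist X.
move/(unif_continuousE _ cX cY) : uu => uu.
move/(unif_continuousE _ cY cX) : vu => vu.
have ufA : ucont_on d A dY (u \o f) by exact: ucont_on_comp fA uu.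
have [k [g [k0 gu gf]]] := unif_ANR_extensor cY aY pd cA ufA.
have [K [KA K0 K1 Ke]] := eps_homotopic_homotopy_to pd vuh fA.
exists k, (v \o g), K; split=> //; first exact: ucont_on_comp gu vu.
split=> // [a Aa|a t Aa It]; first by rewrite K0//= gf.
by apply: le_trans (Ke a t Aa It) _; lra.
Qed.

Lemma embedded_approx_extensor (X : metricType R) (Z : uniformType)
    (i : X -> Z) : unif_ANR R Z -> unif_embedding i ->
  (forall e : R, 0 < e ->
    exists (U : set Z) (XU : unif_nbhd R (range i) U) (phi : U -> X),
      unif_continuous phi /\
      unif_eps_homotopic e
        (phi \o corestrict (fun x => unif_nbhd_sub XU (range_mem i x)))
        idfun) ->
  approx_extensor (@mdist R X).
Proof.
move=> aZ iemb dom e W d A f e0 pd cA fA.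
have [U [XU [phi [phiu phih]]]] := dom _ (ltac:(lra) : 0 < e / 2).
have [[dZ cZ] _] := aZ; have cX := compatible_mdist X.
have [iu _] := (unif_embeddingE _ cX cZ).1 iemb.
have [m m0 mU] := (unif_nbhdP _ _ cZ).1 XU.
move/(unif_continuousE _ (compatible_dsub _ cZ) cX) : phiu => phiu.
have ifA : ucont_on d A dZ (i \o f) by exact: ucont_on_comp fA iu.
have [k [g [k0 gu gf]]] := unif_ANR_extensor cZ aZ pd cA ifA.
have [K [KA K0 K1 Ke]] := eps_homotopic_homotopy_to pd phih fA.
have /choice[h hP] : forall z, exists x, forall u : U, set_val u = g z -> x = phi u.
  move=> z; have [Uz|nU] := pselect (U (g z)); last first.
    by exists (f z) => u uz; case: nU; rewrite -uz; exact: set_valP.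
  exists (phi (SigSub (mem_set Uz))) => u uz; congr phi.
  by apply: val_inj; rewrite -!set_valE uz.
have [n n0 gn] := gu _ m0.
pose q := Num.min k n; have q0 : 0 < q by rewrite lt_min k0.
have gU z : tube d A q z -> exists u : U, set_val u = g z.
  move=> [a Aa]; rewrite lt_min => /andP[ak an]; have Uz : U (g z).
    apply: mU; exists (i (f a)); first by exists (f a).
    rewrite -[i (f a)]gf//; apply: gn => //; first exact: sub_tube.
    by exists a.
  by exists (SigSub (mem_set Uz)).
exists q, h, K; split=> //.
  move=> c c0; have [s s0 phis] := phiu _ c0; have [t t0 gt] := gu _ s0.
  exists t => // x y xq yq xy.
  have [u uE] := gU _ xq; have [v vE] := gU _ yq.
  rewrite (hP _ _ uE) (hP _ _ vE); apply: phis => //; rewrite /dsub uE vE.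
  by apply: gt => //; [apply: tubeS xq|apply: tubeS yq] => //; rewrite ge_min lexx.
split=> // [a Aa|a t Aa It]; last by apply: le_trans (Ke a t Aa It) _; lra.
by rewrite K0//=; apply/esym/hP; rewrite gf.
Qed.

(** [W] is [Z * R] without the points of height [0] off the image of [X], so that
    the image is closed at height [0] although it need not be closed in [Z].
    The extension [g] of the inverse of [i] to a neighborhood in [W] can be
    evaluated at a small height [t0] over every point near the image. *)
Lemma unif_ANR_near_retraction (X : metricType R) (Z : uniformType)
    (i : X -> Z) (e : R) :
  unif_ANR R Z -> unif_embedding i -> unif_ANR R X -> 0 < e ->
  exists (U : set Z) (XU : unif_nbhd R (range i) U) (phi : U -> X),
    unif_continuous phi /\
    unif_eps_homotopic e
      (phi \o corestrict (fun x => unif_nbhd_sub XU (range_mem i x)))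
      idfun.
Proof.
move=> [[dZ cZ] _] iemb aX e0; have cX := compatible_mdist X.
have pZ := compatible_pseudometric cZ; have [dZ0 dZs dZt] := pZ.
have pR := @dreal_pseudometric R; have [r0 _ _] := pR.
have [iu ik] := (unif_embeddingE _ cX cZ).1 iemb.
have cI := compatible_dsub (@unit_itv R) (@compatible_dreal R).
have [[x0 _]|X0] := pselect (exists x : X, True); last first.
  have XU : unif_nbhd R (range i) set0.
    by exists dZ => //; exists 1 => // z [y [x _ _]]; case: X0; exists x.
  exists set0, XU, (fun u : (set0 : set Z) => False_rect _ (set_valP u)).
  split.
    apply/(unif_continuousE _ (compatible_dsub _ cZ) cX) => c c0.
    by exists 1 => // u; case: (set_valP u).
  exists fst; split=> [|x|x|p]; try by case: X0; exists x.
    by apply/(unif_continuousE _ (compatible_dprod cX cI) cX);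
      apply: ucont_on_fst; exact: compatible_pseudometric cI.
  by case: X0; exists p.1.
have /choice[j jP] : forall z, exists x, range i z -> i x = z.
  move=> z; have [[x _ xz]|nz] := pselect (range i z); first by exists x.
  by exists x0.
have ji x : j (i x) = x.
  case: (cX) => [D _ _ _]; apply/D/eqP.
  rewrite eq_le pseudometric_ge0 ?andbT//; last exact: compatible_pseudometric cX.
  rewrite leNgt; apply/negP => h; have [k k0 kxy] := ik _ h.
  have := kxy (j (i x)) x; rewrite jP; last by exists x.
  by rewrite dZ0 => /(_ k0); rewrite ltxx.
pose D : set (Z * R) := [set p | p.2 <> 0 \/ range i p.1].
pose W := set_type D.
pose dW : W -> W -> R := dsub (dprod dZ (@dreal R)).
have pW : pseudometric dW.
  have [w0 ws wt] := dprod_pseudometric pZ pR.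
  by split=> [x|x y|x y z]; [exact: w0|exact: ws|exact: wt].
pose A : set W := [set w | (set_val w).2 = 0].
have Ai w : A w -> range i (set_val w).1.
  by move=> w2; have [|] := set_valP w.
have cA : dclosed dW A.
  move=> w wA; apply/eqP; rewrite -normr_eq0 eq_le normr_ge0 andbT leNgt.
  apply/negP => h; have [a a2] := wA _ h.
  rewrite /dW /dsub /dprod a2.
  have := pseudometric_ge0 pZ (set_val a).1 (set_val w).1.
  by rewrite /dreal sub0r normrN => ? ?; lra.
pose f (w : W) : X := j (set_val w).1.
have fA : ucont_on dW A (@mdist R X) f.
  move=> c /ik[k k0 kxy]; exists k => // w w' Aw Aw' ww'.
  apply: kxy; rewrite /f !jP; [|exact: Ai|exact: Ai].
  move: ww'; rewrite /dW /dsub /dprod.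
  by have := pseudometric_ge0 pR (set_val w).2 (set_val w').2; lra.
have [k [g [k0 gu gf]]] := unif_ANR_extensor cX aX pW cA fA.
have [m m0 gm] := gu _ e0.
pose t0 := Num.min (k / 2) (m / 2).
have t00 : 0 < t0 by rewrite lt_min !divr_gt0.
have [t0k t0m] : t0 <= k / 2 /\ t0 <= m / 2.
  by rewrite !ge_min !lexx orbT.
have D0 : D (i x0, 0) by right; exists x0.
(* [w_] is the inverse of [set_val], made total by an arbitrary value. *)
have /choice[w_ wP] : forall p, exists w : W, D p -> set_val w = p.
  move=> p; have [h|h] := pselect (D p); first by exists (SigSub (mem_set h)).
  by exists (SigSub (mem_set D0)).
have wd p q : D p -> D q -> dW (w_ p) (w_ q) = dprod dZ dreal p q.
  by move=> Dp Dq; rewrite /dW /dsub !wP.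
have Ax x : A (w_ (i x, 0)).
  by rewrite /A/= wP//=; right; exists x.
have Di x t : D (i x, t) by right; exists x.
have Dt0 z : D (z, t0) by left; apply/eqP; rewrite gt_eqF.
pose U := tube dZ (range i) (k / 2).
have XU : unif_nbhd R (range i) U.
  by exists dZ => //; exists (k / 2); rewrite ?divr_gt0.
exists U, XU, (fun u => g (w_ (set_val u, t0))); split.
  apply/(unif_continuousE _ (compatible_dsub _ cZ) cX).
  apply: (@ucont_on_comp _ _ _ _ _ _ _ _ _
    (fun u : U => w_ (set_val u, t0)) _ _ _ gu).
    move=> u _; have [_ [x _ <-] xu] := set_valP u.
    exists (w_ (i x, 0)); rewrite // wd// /dprod/=.
    by rewrite /dreal sub0r normrN gtr0_norm//; lra.
  move=> c c0; exists c => // u v _ _; rewrite /dsub wd// /dprod/=.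
  by rewrite r0 addr0.
pose s (p : X * @unit_itv R) := t0 * (1 - set_val p.2).
have sb p : 0 <= s p <= t0.
  have := set_valP p.2; rewrite /unit_itv/= in_itv/= => /andP[p0 p1].
  rewrite /s; apply/andP; split; last by rewrite ger_pMr// gerBl.
  by apply: mulr_ge0; [exact: ltW|rewrite subr_ge0].
have wtube x t : 0 <= t <= t0 -> tube dW A k (w_ (i x, t)).
  move=> /andP[t1 t2]; exists (w_ (i x, 0)) => //.
  by rewrite wd// /dprod/= dZ0 add0r /dreal sub0r normrN ger0_norm//; lra.
exists (fun p => g (w_ (i p.1, s p))); split.
- apply/(unif_continuousE _ (compatible_dprod cX cI) cX).
  apply: (@ucont_on_comp _ _ _ _ _ _ _ _ _
    (fun p => w_ (i p.1, s p)) _ _ _ gu).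
    by move=> p _; exact: wtube.
  have : ucont_on (dprod (@mdist R X) (dsub (@dreal R))) setT
      (dprod dZ (@dreal R)) (fun p : X * @unit_itv R => (i p.1, s p)).
    apply: ucont_on_pair.
      apply: (@ucont_on_comp _ _ _ _ _ _ _ _ _ fst _ _ _ iu) => //.
      by apply: ucont_on_fst; exact: compatible_pseudometric cI.
    apply: (@lip_ucont_on _ _ _ _ _ _ _ t0) => [|p q _ _]; first exact: ltW.
    rewrite /dprod /dreal /dsub -mulrBr normrM gtr0_norm// ler_pM2l//.
    have -> : 1 - set_val p.2 - (1 - set_val q.2) = set_val q.2 - set_val p.2.
      by lra.
    rewrite distrC lerDr.
    by apply: pseudometric_ge0; exact: compatible_pseudometric cX.
  by move=> h c /h[n n0 hn]; exists n => // p q _ _ pq; rewrite wd//; exact: hn.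
- move=> x; congr (g (w_ (_, _))).
  by rewrite /s [set_val _]/(0 : R) subr0 mulr1.
- move=> x /=; rewrite /s [set_val _]/(1 : R) subrr mulr0 gf// /f.
  by rewrite wP ?ji//=; exact: Di.
- move=> p; apply: gm.
  + exact: wtube.
  + by apply: wtube; rewrite lexx ltW.
  rewrite wd// /dprod/= dZ0 add0r /dreal.
  by have := sb p => /andP[? ?]; rewrite ler0_norm; lra.
Qed.

End Domination.

Theorem corollary13p18 (R : realType) :
  (forall X : metricType R,
     (forall e : R, 0 < e ->
        exists2 Y : uniformType, unif_ANR R Y & unif_eps_dominated e X Y) ->
     unif_ANR R X)
  /\
  (forall (X : metricType R) (Z : uniformType) (i : X -> Z),
     unif_ANR R Z -> unif_embedding i ->
     (unif_ANR R X <->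
      forall e : R, 0 < e ->
        exists (U : set Z) (XU : unif_nbhd R (range i) U) (phi : U -> X),
          unif_continuous phi /\
          unif_eps_homotopic e
            (phi \o corestrict (fun x => unif_nbhd_sub XU (range_mem i x)))
            idfun)).
Proof.
have approx_ANR (X : metricType R) :
    approx_extensor (@mdist R X) -> unif_ANR R X.
  move=> aX; have cX := compatible_mdist X.
  apply: (extensor_unif_ANR cX); apply: approx_extensor_extensor => //.
    exact: compatible_pseudometric.
  exact: mdist_positivity.
split=> [X domX|X Z i aZ iemb].
  by apply: approx_ANR; exact: dominated_approx_extensor.
split=> [aX e|nearX]; first exact: unif_ANR_near_retraction.
by apply: approx_ANR; exact: embedded_approx_extensor aZ iemb nearX.
Qed.
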